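(* Let $\lambda\in\mathbb{R}$. For all $m,k\in\mathbb{Z}$ with $k\ge m\ge 0$, $$\sum_{l=m}^{k}\binom{k}{l}(1-\lambda)_{k-l,\lambda}S_{2,\lambda}(l,m)=S_{2,\lambda}(k+1,m+1).$$
   Context: For $\lambda\in\mathbb{R}$, the generalized falling factorials are $(x)_{0,\lambda}=1$, $(x)_{n,\lambda}=x(x-\lambda)\cdots(x-(n-1)\lambda)$ for $n\ge 1$, and the ordinary falling factorials are $(x)_{0}=1$, $(x)_{n}=x(x-1)\cdots(x-n+1)$ for $n\ge 1$. The degenerate Stirling numbers of the second kind $S_{2,\lambda}(n,k)$, $0\le k\le n$, are defined by the polynomial identity $(x)_{n,\lambda}=\sum_{k=0}^{n}S_{2,\lambda}(n,k)(x)_{k}$ for $n\ge 0$. *)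

(* Defs.v *)
From HB Require Import structures.
From mathcomp Require Import all_boot all_order all_algebra.
From mathcomp Require Import reals.

Set Implicit Arguments.
Unset Strict Implicit.
Unset Printing Implicit Defensive.

Import GRing.Theory.
Local Open Scope ring_scope.

(* Over an arbitrary commutative ring A, so that x may be a scalar or the
   polynomial variable 'X (with step lam%:P). *)
Definition gen_ffact (A : comNzRingType) (lam x : A) (n : nat) : A :=
  \prod_(i < n) (x - i%:R * lam).

Definition ord_ffact (A : comNzRingType) (x : A) (n : nat) : A :=
  \prod_(i < n) (x - i%:R).

Definition stirling2_expansion (R : comNzRingType) (lam : R) (n : nat)
    (c : nat -> R) : Prop :=
  gen_ffact lam%:P 'X n = \sum_(0 <= k < n.+1) c k *: ord_ffact 'X k :> {poly R}.

Lemma stirling2_expansion_exists (R : comNzRingType) (lam : R) (n : nat) :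
  {c : nat -> R | stirling2_expansion lam n c}.
Proof.
rewrite /stirling2_expansion /gen_ffact.
elim: n => [|n [c IHc]].
  by exists (fun=> 1); rewrite big_nat1 /ord_ffact !big_ord0 scale1r.
exists (fun k => (if (k <= n)%N then (k%:R - n%:R * lam) * c k else 0)
                 + (if k is j.+1 then c j else 0)).
rewrite big_ord_recr /= IHc mulr_suml.
under [RHS]eq_bigr do rewrite scalerDl.
rewrite big_split /= [X in _ = X + _]big_nat_recr //= ltnn scale0r addr0.
rewrite [X in _ = _ + X]big_nat_recl //= scale0r add0r -big_split /=.
apply: eq_big_nat => k /andP[_ ltkn]; rewrite -ltnS ltkn.
rewrite /ord_ffact big_ord_recr /= -/(ord_ffact _ k).
rewrite mulrC [X in _ + _ *: X]mulrC [_ * c k]mulrC -scalerA -scalerDr.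
rewrite -scalerAr; congr (_ *: _).
rewrite -mul_polyC -mulrDl; congr (_ * _).
by rewrite polyCB polyCM !polyC_natr [RHS]addrC addrA subrK.
Qed.

Lemma stirling2_expansion_unique (R : comNzRingType) (lam : R) (n : nat)
    (c d : nat -> R) :
  stirling2_expansion lam n c -> stirling2_expansion lam n d ->
  forall k, (k <= n)%N -> c k = d k.
Proof.
rewrite /stirling2_expansion => -> {lam}.
have factE k : ord_ffact 'X k = \prod_(i < k) ('X - (i%:R : R)%:P).
  by apply: eq_bigr => i _; rewrite polyC_natr.
have sizeF k : size (ord_ffact ('X : {poly R}) k) = k.+1.
  by rewrite factE size_prod_XsubC /index_enum -enumT size_enum_ord.
have lcF k : (ord_ffact ('X : {poly R}) k)`_k = 1.
  have /monicP : ord_ffact ('X : {poly R}) k \is monic.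
    by rewrite factE monic_prod_XsubC.
  by rewrite lead_coefE sizeF.
have coefS e m : (\sum_(0 <= k < m.+1) e k *: ord_ffact ('X : {poly R}) k)`_m
    = e m.
  rewrite big_nat_recr //= coefD coefZ lcF mulr1 coef_sum big_nat big1 ?add0r //.
  by move=> i /andP[_ ltim]; rewrite coefZ nth_default ?mulr0 // sizeF.
elim: n => [|n IHn] eqcd k.
  by rewrite leqn0 => /eqP->; rewrite -(coefS c 0) eqcd coefS.
have eqn : c n.+1 = d n.+1 by rewrite -(coefS c) eqcd coefS.
rewrite leq_eqVlt => /predU1P[-> //|]; apply: IHn.
move: eqcd; rewrite big_nat_recr //= [RHS]big_nat_recr //= eqn.
exact: addIr.
Qed.

(* S_{2,lam}(n, k) is meaningful for k <= n, where it is determined by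
   [stirling2_expansion_unique]; its value for k > n is unspecified. *)
Definition deg_stirling2 (R : comNzRingType) (lam : R) (n k : nat) : R :=
  sval (stirling2_expansion_exists lam n) k.

Lemma deg_stirling2P (R : comNzRingType) (lam : R) (n : nat) :
  stirling2_expansion lam n (deg_stirling2 lam n).
Proof. exact: svalP. Qed.

(* Main.v *)
Require Import Defs.
From mathcomp Require Import all_boot all_order all_algebra.
From mathcomp Require Import reals.
From mathcomp Require Import ring.
Import GRing.Theory.
Local Open Scope ring_scope.

(** Both sides are coefficients of one polynomial in the basis of ordinary
    falling factorials.  Splitting off the first factor of
    (x)_{k+1,lam} = x (x - lam) (x - 2 lam) ... leaves the generalized falling
    factorial of x - lam = (1 - lam) + (x - 1), which the binomial theorem
    [gen_ffactD] expands in the (x - 1)_{l,lam}.  The defining expansion of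
    these, shifted by one ([deg_stirling2_shift]), involves only the
    (x - 1)_m, and the factor x set aside turns (x - 1)_m into (x)_{m+1}.  So
    the sums on the left are the coefficients of (x)_{k+1,lam} at (x)_{m+1}
    ([gen_ffact_expansion_succ]); by uniqueness of the expansion they are the
    degenerate Stirling numbers on the right. *)

Lemma gen_ffactSr (A : comNzRingType) (lam x : A) (n : nat) :
  gen_ffact lam x n.+1 = gen_ffact lam x n * (x - n%:R * lam).
Proof. by rewrite /gen_ffact big_ord_recr. Qed.

Lemma gen_ffactSl (A : comNzRingType) (lam x : A) (n : nat) :
  gen_ffact lam x n.+1 = x * gen_ffact lam (x - lam) n.
Proof.
rewrite /gen_ffact big_ord_recl /= mul0r subr0; congr (_ * _).
by apply: eq_bigr => i _; rewrite /bump /= -natr1; ring.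
Qed.

Lemma ord_ffactSl (A : comNzRingType) (x : A) (n : nat) :
  ord_ffact x n.+1 = x * ord_ffact (x - 1) n.
Proof.
rewrite /ord_ffact big_ord_recl /= subr0; congr (_ * _).
by apply: eq_bigr => i _; rewrite /bump /= -natr1; ring.
Qed.

(** The binomial theorem for generalized falling factorials.  In the induction
    the new factor x + y - n lam is split as
    (x - (n - i) lam) + (y - i lam), each part prolonging one of the two
    falling factorials of the i-th term; Pascal's rule collects the result. *)
Lemma gen_ffactD (A : comNzRingType) (lam x y : A) (n : nat) :
  gen_ffact lam (x + y) n =
  \sum_(0 <= i < n.+1)
     'C(n, i)%:R * gen_ffact lam x (n - i) * gen_ffact lam y i.
Proof.
elim: n => [|n IHn].
  by rewrite big_nat1 /gen_ffact !big_ord0 !mulr1.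
rewrite gen_ffactSr IHn mulr_suml.
have split_factor i : (0 <= i < n.+1)%N ->
    'C(n, i)%:R * gen_ffact lam x (n - i) * gen_ffact lam y i
      * (x + y - n%:R * lam)
  = 'C(n, i)%:R * gen_ffact lam x (n.+1 - i) * gen_ffact lam y i
    + 'C(n, i)%:R * gen_ffact lam x (n - i) * gen_ffact lam y i.+1.
  move=> /andP[_]; rewrite ltnS => lein.
  rewrite subSn // !gen_ffactSr -{3}(subnK lein) natrD; ring.
rewrite (eq_big_nat _ _ split_factor) big_split /= [RHS]big_nat_recl //=.
under [X in _ = _ + X]eq_bigr do rewrite binS subSS natrD !mulrDl.
rewrite big_split /= addrA; congr (_ + _).
by rewrite big_nat_recl // [in RHS]big_nat_recr //= (bin_small (ltnSn n))
  !mul0r addr0 !bin0.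
Qed.

(** The expansion defining the degenerate Stirling numbers is an identity in
    {poly R}, so 'X - 1 may be substituted for 'X. *)
Lemma deg_stirling2_shift (R : comNzRingType) (lam : R) (n : nat) :
  gen_ffact lam%:P ('X - 1) n =
  \sum_(0 <= j < n.+1) deg_stirling2 lam n j *: ord_ffact ('X - 1) j.
Proof.
have /(congr1 (comp_poly ('X - 1))) := deg_stirling2P lam n.
rewrite /gen_ffact /ord_ffact rmorph_prod raddf_sum /=.
under eq_bigr do
  rewrite rmorphB rmorphM /= rmorph_nat comp_polyX comp_polyC.
move=> ->; apply: eq_bigr => j _; rewrite comp_polyZ rmorph_prod /=.
congr (_ *: _); apply: eq_bigr => i _.
by rewrite rmorphB /= rmorph_nat comp_polyX.
Qed.

Lemma gen_ffactC (R : comNzRingType) (lam x : R) (n : nat) :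
  gen_ffact lam%:P x%:P n = (gen_ffact lam x n)%:P.
Proof.
rewrite /gen_ffact rmorph_prod; apply: eq_bigr => i _.
by rewrite rmorphB rmorphM /= rmorph_nat.
Qed.

(** The constant coefficient is 0 because 'X divides the left-hand side. *)
Lemma gen_ffact_expansion_succ (R : comNzRingType) (lam : R) (k : nat) :
  stirling2_expansion lam k.+1 (fun j => if j is m.+1 then
    \sum_(m <= l < k.+1)
       'C(k, l)%:R * gen_ffact lam (1 - lam) (k - l) * deg_stirling2 lam l m
    else 0).
Proof.
rewrite /stirling2_expansion gen_ffactSl big_nat_recl //= scale0r add0r.
have -> : 'X - lam%:P = (1 - lam)%:P + ('X - 1) :> {poly R}.
  by rewrite polyCB; ring.
rewrite gen_ffactD mulr_sumr.
under [LHS]eq_bigr do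
  rewrite gen_ffactC -polyC_natr -polyCM mul_polyC deg_stirling2_shift
    scaler_sumr mulr_sumr.
under [RHS]eq_bigr do rewrite scaler_suml.
(* The two sides sum over the same triangle m <= l <= k, in opposite orders. *)
have widen l : (0 <= l < k.+1)%N -> forall F : nat -> {poly R},
    \sum_(0 <= j < l.+1) F j = \sum_(0 <= j < k.+1 | (j <= l)%N) F j.
  by move=> /andP[_ ltlk] F; rewrite (big_nat_widen _ _ k.+1).
under eq_big_nat do rewrite widen //.
under [RHS]eq_bigr do rewrite (big_nat_widenl _ 0%N) //.
rewrite (exchange_big_dep_nat xpredT) //=.
apply: eq_bigr => j _; apply: eq_bigr => l _.
by rewrite ord_ffactSl -!scalerAr scalerA.
Qed.

Theorem theorem3 (R : realType) (lam : R) (m k : nat) (hmk : (m <= k)%N) :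
  \sum_(m <= l < k.+1)
     'C(k, l)%:R * gen_ffact lam (1 - lam) (k - l) * deg_stirling2 lam l m
  = deg_stirling2 lam k.+1 m.+1.
Proof.
exact: (stirling2_expansion_unique (gen_ffact_expansion_succ _ lam k)
         (deg_stirling2P lam k.+1) (hmk : m.+1 <= k.+1)%N).
Qed.
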